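(* The algebra $\mathrm{QSym}$ is graded by the rank of the compositions indexing the basis $\{N_\alpha\}$; that is, for all compositions $\alpha,\beta$, the product $N_\alpha N_\beta$ lies in the span of the $N_\nu$ with $r(\nu)=r(\alpha)+r(\beta)$. Furthermore, the structure constants for $\{N_\alpha\}$ are nonnegative: for all compositions $\alpha,\beta$, in the expansion $$N_\alpha N_\beta=\sum_\nu c^\nu_{\alpha,\beta}N_\nu,$$ all the constants $c^\nu_{\alpha,\beta}$ are nonnegative integers.
   Context: A composition $\alpha=(\alpha_1,\dots,\alpha_m)$ is a finite (possibly empty) sequence of positive integers; $\ell(\alpha)=m$ is its length and $|\alpha|=\alpha_1+\cdots+\alpha_m$ its weight. The empty composition is denoted $\mathbf{0}$. The rank of $\alpha$ is $r(\alpha)=\alpha_1+\alpha_3+\alpha_5+\cdots$ (sum of odd-indexed parts). For compositions of the same weight $n$, $\beta$ refines $\alpha$ ($\beta\preccurlyeq\alpha$) if the set of proper partial sums of $\alpha$ (a subset of $\{1,\dots,n-1\}$) is contained in that of $\beta$. $\mathrm{QSym}$ is the ring of quasisymmetric functions in the ordered variables $x_1,x_2,\dots$, with monomial basis $\mathbf{x}^\alpha=\sum_{1\le i_1<\cdots<i_m}x_{i_1}^{\alpha_1}\cdots x_{i_m}^{\alpha_m}$ and fundamental basis $L_\alpha=\sum_{\beta\preccurlyeq\alpha}\mathbf{x}^\beta$ (with $L_{\mathbf 0}=1$). A permutation of a finite set $X$ of positive integers is a sequence $\pi$ listing each element of $X$ exactly once; $C(\pi)$ is the composition whose parts are the lengths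 of the successive maximal increasing runs of $\pi$. A labeled poset $P$ is a partial order $\le_P$ on a finite set of positive integers (the labels). $\mathcal{L}(P)$ is the set of linear extensions of $P$, i.e. permutations of the label set in which $x$ appears before $y$ whenever $x<_P y$. The quasisymmetric function of $P$ is $F(P)=\sum_{\pi\in\mathcal{L}(P)}L_{C(\pi)}$. $P\oplus Q$ denotes the ordinal sum of posets (all elements of $P$ lie below all elements of $Q$). For a nonempty composition $\alpha$ with $\ell(\alpha)=m$, let $P_\alpha=A_1\oplus\cdots\oplus A_m$, where $A_i$ is an antichain with $\alpha_i$ elements, labeled by $1,\dots,|\alpha|$ as follows: first the elements of $A_2,A_4,\dots$ are numbered consecutively, followed by the elements of $A_1,A_3,\dots$. Define $N_\alpha=F(P_\alpha)$, and $N_{\mathbf 0}=1$. The set $\{N_\alpha\}$, over all compositions $\alpha$, is a $\mathbb{Z}$-basis of $\mathrm{QSym}$. *)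

(* Defs.v *)
From HB Require Import structures.
From mathcomp Require Import all_boot all_order all_algebra.
From mathcomp Require Import finmap monalg boolp.

Set Implicit Arguments.
Unset Strict Implicit.
Unset Printing Implicit Defensive.

Import Order.TTheory GRing.Theory Num.Theory.

Local Open Scope fset_scope.
Local Open Scope ring_scope.

(* Formal power series with integer coefficients in countably many variables. *)
(* The variable x_(i+1) is the generator U_(i) of {cmonom nat}, and a series  *)
(* is the function sending a monomial to its coefficient. QSym is a subring   *)
(* of this ring.                                                              *)

Definition mdivs (m : {cmonom nat}) : {fset {cmonom nat}} :=
  [fset d in [seq [cmonom (g i : nat) | i : finsupp m]%M
             | g : {ffun finsupp m -> 'I_(mdeg m).+1}]
  | mmul d (divcm m d) == m].

Lemma mdivsP (m d : {cmonom nat}) :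
  reflect (mmul d (divcm m d) = m) (d \in mdivs m).
Proof.
rewrite !inE /=; apply: (iffP andP) => [[_ /eqP//]|dm]; split; last exact/eqP.
have le_dm i : (d i <= m i)%N by rewrite -[in leqRHS]dm cmM leq_addr.
have lt_d (i : finsupp m) : (d (val i) < (mdeg m).+1)%N.
  rewrite ltnS (leq_trans (le_dm _)) // mdegE.
  by rewrite (big_fsetD1 (val i)) ?valP //= leq_addr.
apply/imageP; exists [ffun i => Ordinal (lt_d i)] => //=.
apply/eqP/cmP => i; rewrite cmE.
case: (finsuppP m i) => im.
  by rewrite fsfun_ffun insubF ?(negbTE im) //; move: (le_dm i);
     rewrite (fsfun_dflt im) leqn0 => /eqP.
by rewrite fsfun_ffun insubT /= ffunE.
Qed.

Lemma mdivs_mul (m d e : {cmonom nat}) : mmul d e = m ->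
  [/\ d \in mdivs m, e \in mdivs m & e = divcm m d].
Proof.
move=> dem; have ed : divcm m d = e.
  by apply/eqP/cmP => i; rewrite divcmE -dem cmM addKn.
have de : divcm m e = d.
  by apply/eqP/cmP => i; rewrite divcmE -dem cmM addnK.
by split=> //; apply/mdivsP; rewrite ?ed // de mulmC.
Qed.

Record fps := FPS { coef :> {cmonom nat} -> int }.

Lemma fpsP (f g : fps) : (forall m, f m = g m) <-> f = g.
Proof.
case: f g => [f] [g]; split=> [fg|[->]//].
by congr FPS; apply/funext.
Qed.

HB.instance Definition _ := gen_eqMixin fps.
HB.instance Definition _ := gen_choiceMixin fps.

Definition fps_zero := FPS (fun=> 0).
Definition fps_one := FPS (fun m => (m == mone)%:R).
Definition fps_opp (f : fps) := FPS (fun m => - f m).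
Definition fps_add (f g : fps) := FPS (fun m => f m + g m).
Definition fps_mul (f g : fps) :=
  FPS (fun m => \sum_(d <- mdivs m) f d * g (divcm m d)).

Fact fps_addA : associative fps_add.
Proof. by move=> f g h; apply/fpsP => m /=; rewrite addrA. Qed.

Fact fps_addC : commutative fps_add.
Proof. by move=> f g; apply/fpsP => m /=; rewrite addrC. Qed.

Fact fps_add0 : left_id fps_zero fps_add.
Proof. by move=> f; apply/fpsP => m /=; rewrite add0r. Qed.

Fact fps_addN : left_inverse fps_zero fps_opp fps_add.
Proof. by move=> f; apply/fpsP => m /=; rewrite addNr. Qed.

HB.instance Definition _ :=
  GRing.isZmodule.Build fps fps_addA fps_addC fps_add0 fps_addN.

Definition fps_trunc (D : {fset {cmonom nat}}) (f : fps) :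
    {malg int[{cmonom nat}]} :=
  [malg k in D => f k].

Lemma fps_truncE (D : {fset {cmonom nat}}) f k :
  k \in D -> (fps_trunc D f)@_k = f k.
Proof. by rewrite mcoeffE => ->. Qed.

Lemma fps_mulE (A B : {malg int[{cmonom nat}]}) (f g : fps) m :
    {in mdivs m, forall k, A@_k = f k} -> {in mdivs m, forall k, B@_k = g k} ->
  fps_mul f g m = (A * B)@_m.
Proof.
move=> fA gB; pose D := mdivs m `|` (msupp A `|` msupp B).
have sA : msupp A `<=` D by apply/fsubsetP => k kA; rewrite !in_fsetU kA ?orbT.
have sB : msupp B `<=` D by apply/fsubsetP => k kB; rewrite !in_fsetU kB ?orbT.
have sD : mdivs m `<=` D by apply/fsubsetP => k kD; rewrite !in_fsetU kD.
rewrite (mcoeffMlw _ sA sB) /= -(big_fset_incl _ sD) /=; last first.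
  move=> k _ kN; apply: big1_seq => k' _.
  case: eqP => [/mdivs_mul[kk]|_]; last by rewrite mulr0n.
  by rewrite kk in kN.
rewrite big_seq [RHS]big_seq; apply: eq_bigr => d dm.
have dme := mdivsP _ _ dm; have [_ em _] := mdivs_mul dme.
rewrite (big_fsetD1 (divcm m d)) /=; last exact: (fsubsetP sD).
rewrite dme eqxx mulr1n fA // gB // big1_seq ?addr0 // => k' /andP[_ k'D].
case: eqP => [/mdivs_mul[_ _ kk]|_]; last by rewrite mulr0n.
by rewrite in_fsetD1 kk eqxx in k'D.
Qed.

Lemma mdivs_trans (m d : {cmonom nat}) : d \in mdivs m -> mdivs d `<=` mdivs m.
Proof.
move/mdivsP=> dm; apply/fsubsetP => e /mdivsP ed.
by rewrite -ed -mulmA in dm; case: (mdivs_mul dm).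
Qed.

Lemma fps_mul_trunc (D : {fset {cmonom nat}}) f g m : mdivs m `<=` D ->
  (fps_trunc D f * fps_trunc D g)@_m = fps_mul f g m.
Proof.
move/fsubsetP=> sD; symmetry; apply: fps_mulE => k /sD kD; exact: fps_truncE.
Qed.

Fact fps_mulC : commutative fps_mul.
Proof.
move=> f g; apply/fpsP => m.
by rewrite -!(fps_mul_trunc _ _ (fsubset_refl (mdivs m))) mulrC.
Qed.

Fact fps_mulA : associative fps_mul.
Proof.
move=> f g h; apply/fpsP => m; pose T := fps_trunc (mdivs m).
rewrite (@fps_mulE (T f) (T g * T h)) ?(@fps_mulE (T f * T g) (T h)) ?mulrA //;
  by move=> k km; rewrite ?fps_truncE ?fps_mul_trunc // mdivs_trans.
Qed.

Fact fps_mul1 : left_id fps_one fps_mul.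
Proof.
move=> f; apply/fpsP => m; rewrite (@fps_mulE 1 (fps_trunc (mdivs m) f)).
- by rewrite mul1r fps_truncE //; case: (@mdivs_mul m m mone (mulm1 _)).
- by move=> k _; rewrite mcoeffU1 eq_sym.
- by move=> k km; rewrite fps_truncE.
Qed.

Fact fps_mulDl : left_distributive fps_mul fps_add.
Proof.
move=> f g h; apply/fpsP => m /=; rewrite -big_split /=.
by apply: eq_bigr => d _; rewrite mulrDl.
Qed.

Fact fps_one_neq0 : fps_one != 0.
Proof. by apply/eqP => /fpsP/(_ mone) /=; rewrite eqxx. Qed.

HB.instance Definition _ := GRing.Zmodule_isComNzRing.Build fps
  fps_mulA fps_mulC fps_mul1 fps_mulDl fps_one_neq0.

Record composition := Composition {
  parts :> seq nat;
  parts_gt0 : all (ltn 0) parts }.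

HB.instance Definition _ := [isSub for parts].
HB.instance Definition _ := [Countable of composition by <:].

Definition comp0 : composition := @Composition [::] isT.

Definition weight (a : composition) : nat := sumn a.

(* Parts are indexed from 0, so the odd-indexed parts a_1, a_3, ... are those *)
(* with an even index here.                                                   *)
Definition rank (a : composition) : nat :=
  (\sum_(i < size a | ~~ odd i) nth 0 a i)%N.

Definition psums (a : composition) : seq nat :=
  [seq sumn (take k a) | k <- iota 1 (size a).-1].

Definition refines (b a : composition) : bool :=
  (weight b == weight a) && all (mem (psums b)) (psums a).

Fixpoint comp_seqs (n : nat) : seq (seq nat) :=
  match n with
  | 0 => [:: [::]]
  | n'.+1 =>
    if n' is 0 then [:: [:: 1%N]] else
    [seq 1%N :: s | s <- comp_seqs n'] ++
    [seq (head 0%N s).+1 :: behead s | s <- comp_seqs n']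
  end.

Definition compositions (n : nat) : seq composition :=
  pmap insub (comp_seqs n).

Lemma mem_comp_seqs n s :
  (s \in comp_seqs n) = (all (ltn 0) s && (sumn s == n)).
Proof.
elim: n s => [|[|n] IHn] s; first by case: s => [|[|a] s];
    rewrite inE //= ?addSn ?andbF.
  by case: s => [|[|[|a]] [|[|b] s]]; rewrite inE //= ?addSn ?andbF.
rewrite [comp_seqs _]/= mem_cat; apply/orP/andP.
  case=> /mapP[t]; rewrite -/(comp_seqs n.+1) IHn => /andP[t0 /eqP tn] ->.
    by rewrite /= t0 tn.
  case: t t0 tn => [|a t] //= /andP[a0 ->] <-.
  by rewrite addSn.
case: s => [|[|[|a]] s] [] //= s0 /eqP[sn].
  left; apply/mapP; exists s => //; rewrite -/(comp_seqs n.+1) IHn s0.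
  exact/eqP.
right; apply/mapP; exists (a.+1 :: s) => //.
by rewrite -/(comp_seqs n.+1) IHn /= s0 addSn sn eqxx.
Qed.

Lemma mem_compositions n a : (a \in compositions n) = (weight a == n).
Proof. by rewrite mem_pmap_sub mem_comp_seqs parts_gt0. Qed.

Lemma compositions_uniq n : uniq (compositions n).
Proof.
apply: pmap_sub_uniq; elim: n => [|[|n] IHn] //.
rewrite [comp_seqs _]/= cat_uniq -/(comp_seqs n.+1).
rewrite map_inj_uniq ?IHn; last by move=> s t [].
rewrite map_inj_in_uniq ?IHn ?andbT; last first.
  move=> s t; rewrite !mem_comp_seqs => /andP[_ /eqP ss] /andP[_ /eqP st].
  by case: s t ss st => [|a s] [|b t] //= _ _ [-> ->].
apply/hasPn => s /mapP[t]; rewrite mem_comp_seqs => /andP[t0 /eqP tn] ->.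
by apply/mapP => -[u _ []]; case: t t0 tn => [|[|a] t].
Qed.

(* The nonzero exponents of a monomial, by increasing index of the variables. *)
Definition exponents (m : {cmonom nat}) : seq nat :=
  [seq m i | i <- sort leq (finsupp m)].

(* A monomial x_(i_1)^(a_1) ... x_(i_k)^(a_k) with i_1 < ... < i_k and all    *)
(* a_j > 0 determines the indices i_j, so the coefficients are 0 or 1.        *)
Definition Mfun (a : composition) : fps :=
  FPS (fun m => (exponents m == a)%:R).

Definition Lfun (a : composition) : fps :=
  \sum_(b <- compositions (weight a) | refines b a) Mfun b.

Fixpoint run_lengths (s : seq nat) : seq nat :=
  if s is x :: t then
    if t is y :: _ then
      if (x < y)%N then (head 0%N (run_lengths t)).+1 :: behead (run_lengths t)
      else 1%N :: run_lengths t
    else [:: 1%N]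
  else [::].

Fact run_lengths_gt0 s : all (ltn 0) (run_lengths s).
Proof.
elim: s => [|x [|y t] IHs] //.
rewrite [run_lengths _]/= -/(run_lengths (y :: t)).
move: (run_lengths _) IHs => r r0; case: ifP => _; rewrite /= ?r0 //.
by case: r r0 => [|a r] //= /andP[].
Qed.

Definition descent_comp (p : seq nat) : composition :=
  Composition (run_lengths_gt0 p).

Record lposet := LPoset {
  labels : {fset nat};
  ple : rel nat;
  labels_gt0 : {in labels, forall x, (0 < x)%N};
  ple_refl : {in labels, reflexive ple};
  ple_anti : {in labels &, antisymmetric ple};
  ple_trans : {in labels & &, transitive ple} }.

Definition plt (P : lposet) (x y : nat) : bool := (x != y) && ple P x y.

Definition is_linext (P : lposet) (p : seq nat) : bool :=
  allrel (fun x y => plt P x y ==> (index x p < index y p)%N)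
         (labels P) (labels P).

Definition linexts (P : lposet) : seq (seq nat) :=
  [seq p <- permutations (labels P) | is_linext P p].

Definition qsymF (P : lposet) : fps :=
  \sum_(p <- linexts P) Lfun (descent_comp p).

(* The antichain labeled by k+1, ..., k+n. *)
Section Antichain.
Variables k n : nat.
Let X : {fset nat} := [fset x in iota k.+1 n].

Fact antichain_gt0 : {in X, forall x, (0 < x)%N}.
Proof. by move=> x; rewrite !inE /= mem_iota => /andP[/(leq_ltn_trans _)->]. Qed.

Fact antichain_refl : {in X, reflexive (@eq_op nat)}.
Proof. by move=> x _; exact: eqxx. Qed.

Fact antichain_anti : {in X &, antisymmetric (@eq_op nat)}.
Proof. by move=> x y _ _ /andP[/eqP]. Qed.

Fact antichain_trans : {in X & &, transitive (@eq_op nat)}.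
Proof. by move=> y x z _ _ _ /eqP->. Qed.

Definition antichain : lposet :=
  LPoset antichain_gt0 antichain_refl antichain_anti antichain_trans.
End Antichain.

(* The ordinal sum is meant for disjoint label sets. To make it total, a      *)
(* label shared by P and Q is taken in P only.                                *)
Section OrdinalSum.
Variables P Q : lposet.
Let X : {fset nat} := labels P `|` labels Q.
Let le : rel nat := fun x y =>
  if x \in labels P then (y \in labels P) ==> ple P x y
  else (y \notin labels P) && ple Q x y.

Let inQ x : x \in X -> x \notin labels P -> x \in labels Q.
Proof. by rewrite inE => /orP[->|]. Qed.

Fact osum_gt0 : {in X, forall x, (0 < x)%N}.
Proof. by move=> x; rewrite inE => /orP[]; apply: labels_gt0. Qed.

Fact osum_refl : {in X, reflexive le}.
Proof.
move=> x xX; rewrite /le; case: (boolP (x \in labels P)) => xP /=.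
  exact: ple_refl.
by apply: ple_refl; apply: inQ.
Qed.

Fact osum_anti : {in X &, antisymmetric le}.
Proof.
move=> x y xX yX; rewrite /le.
case: (boolP (x \in labels P)) => xP; case: (boolP (y \in labels P)) => yP //=.
  exact: ple_anti.
by apply: ple_anti; apply: inQ.
Qed.

Fact osum_trans : {in X & &, transitive le}.
Proof.
move=> y x z yX xX zX; rewrite /le.
case: (boolP (x \in labels P)) => xP; case: (boolP (y \in labels P)) => yP;
  case: (boolP (z \in labels P)) => zP //=.
  exact: ple_trans.
by apply: ple_trans; apply: inQ.
Qed.

Definition osum : lposet := LPoset osum_gt0 osum_refl osum_anti osum_trans.
End OrdinalSum.

(* The number of labels used before those of the block with (0-based) index i:*)
(* the blocks with odd 0-based index (A_2, A_4, ...) are labeled first.       *)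
Definition block_start (a : composition) (i : nat) : nat :=
  if odd i then (\sum_(j < i | odd j) nth 0 a j)%N
  else (\sum_(j < size a | odd j) nth 0 a j +
        \sum_(j < i | ~~ odd j) nth 0 a j)%N.

Definition comp_poset (a : composition) : lposet :=
  \big[osum/antichain 0 0]_(i < size a) antichain (block_start a i) (nth 0%N a i).

Definition Nfun (a : composition) : fps := qsymF (comp_poset a).

Lemma Lfun0 : Lfun comp0 = 1.
Proof.
rewrite /Lfun (_ : compositions _ = [:: comp0]); last first.
  apply: perm_small_eq => //; apply: uniq_perm => // [|b].
    exact: compositions_uniq.
  rewrite mem_compositions inE; apply/eqP/eqP => [|->//].
  by case: b => -[|[|b] s] // s0 _; apply: val_inj.
rewrite big_cons big_nil /= addr0; apply/fpsP => m /=; congr (nat_of_bool _)%:R.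
rewrite -size_eq0 size_map size_sort -[size _]/#|` finsupp m| cardfs_eq0.
apply/eqP/eqP => [m0|->]; last exact: mdom1.
by apply/eqP/cmP => i; rewrite cm1 fsfun_dflt // m0.
Qed.

Lemma Nfun0 : Nfun comp0 = 1.
Proof.
rewrite /Nfun /comp_poset big_ord0 /qsymF /linexts.
rewrite (_ : labels _ = fset0); last by apply/fsetP => x; rewrite !inE.
rewrite (_ : permutations _ = [:: [::]]); last first.
  by [].
rewrite big_filter big_cons big_nil /= /is_linext.
rewrite (_ : labels _ = fset0) /=; last by apply/fsetP => x; rewrite !inE.
by rewrite addr0 -Lfun0; congr Lfun; apply: val_inj.
Qed.

Definition Ncomb (c : {fsfun composition -> int with 0}) : fps :=
  \sum_(nu <- finsupp c) Nfun nu *~ c nu.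

Definition in_Nspan (S : pred composition) (f : fps) : Prop :=
  exists c : {fsfun composition -> int with 0},
    {in finsupp c, forall nu, S nu} /\ f = Ncomb c.

(* Main.v *)
(* Colour a point of P_alpha red or blue according to whether it lies in one of
   A_1, A_3, ... or in one of A_2, A_4, ..., and order the coloured values by
   (1, blue) < (1, red) < (2, blue) < (2, red) < ... The P_alpha-partitions are
   exactly the assignments of values for which points of different colours in
   successive blocks are strictly increasing for this order. Superposing one for
   alpha and one for beta and cutting the union of the two point sets into
   maximal monochromatic runs gives a partition for a unique P_nu. So
   N_alpha N_beta is a sum of N_nu over block structures on the union, and the
   rank is preserved since it counts the red points.
   For the uniqueness of the coefficients, let B_alpha be the weakly increasing
   word with alpha_(i+1) letters i. Some linear extension of P_beta has its
   descents exactly at the k for which the (k+1)-st letter of B_beta is odd, and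
   any linear extension of P_alpha with this descent set forces B_alpha <= B_beta
   letterwise. So the N_alpha are triangular with respect to the L's. *)
Require Import Defs.
From mathcomp Require Import all_boot all_order all_algebra.
From mathcomp Require Import finmap monalg zify.

Import Order.TTheory GRing.Theory Num.Theory.
Set Implicit Arguments.
Unset Strict Implicit.
Unset Printing Implicit Defensive.

Local Open Scope ring_scope.

(** * Coefficients of the fundamental quasisymmetric functions *)

(** Monomials are handled as words of variable indices; every monomial has exactly one weakly
    increasing word, and coefficients are tested on these. *)
Definition mon (s : seq nat) : {cmonom nat} := \big[mmul/mone]_(i <- s) ucm i.

Lemma monE s i : mon s i = count_mem i s.
Proof.
elim: s => [|x s IHs]; rewrite /mon ?big_nil ?cm1 // big_cons cmM cmU.
by rewrite -/(mon s) IHs.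
Qed.

Lemma mon_cat s t : mon (s ++ t) = mmul (mon s) (mon t).
Proof. by rewrite /mon big_cat. Qed.

Lemma eq_mon s t : (mon s == mon t) = perm_eq s t.
Proof.
apply/eqP/idP => [st|/permP st]; last by apply/eqP/cmP => i; rewrite !monE st.
by apply/allP => x _ /=; rewrite -!monE st.
Qed.

Lemma mon_surj m : exists2 s, sorted leq s & m = mon s.
Proof.
exists (sort leq (flatten [seq nseq (m i) i | i <- finsupp m])).
  exact/sort_sorted/leq_total.
apply/eqP/cmP => i; rewrite monE count_sort.
rewrite count_flatten -map_comp (eq_map (g := fun j => (i == j) * m i)%N); last first.
  by move=> j /=; rewrite count_nseq /= eq_sym; case: eqP => // ->.
have sumE (r : seq nat) : uniq r ->
    sumn [seq ((i == j) * m i)%N | j <- r] = ((i \in r) * m i)%N.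
  elim: r => [|x r IHr] //= /andP[xr /IHr->]; rewrite in_cons.
  by case: eqVneq => [->|_]; rewrite ?(negbTE xr) ?mul0n ?mul1n ?addn0 ?add0n.
by rewrite sumE ?fset_uniq //; case: mdomP; rewrite ?mul1n ?mul0n.
Qed.

Section RunLengths.
Variables (T : eqType) (x0 : T).
Implicit Types (e : rel T) (s : seq T).

(** One notion covers both sides of a coefficient: with [ltn] it gives the increasing runs of a
    permutation, with [eq_op] the exponents of a sorted word. *)
Fixpoint runs e s : seq nat :=
  if s is x :: t then
    if t is y :: _ then
      if e x y then (head 0%N (runs e t)).+1 :: behead (runs e t)
      else 1%N :: runs e t
    else [:: 1%N]
  else [::].

Lemma runs_cons e x s : exists a r, runs e (x :: s) = a.+1 :: r.
Proof.
elim: s x => [|y s IHs] x; first by exists 0%N, [::].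
have [a [r rE]] := IHs y; rewrite [runs _ _]/= -/(runs e (y :: s)) rE /=.
by case: ifP => _; do 2!eexists.
Qed.

Lemma runs_gt0 e s : all (ltn 0) (runs e s).
Proof.
elim: s => [|x [|y s] IHs] //; rewrite [runs _ _]/= -/(runs e (y :: s)).
have [a [r rE]] := runs_cons e y s; move: IHs; rewrite rE /= => IHs.
by case: ifP => _ /=.
Qed.

Lemma sumn_runs e s : sumn (runs e s) = size s.
Proof.
elim: s => [|x [|y s] IHs] //; rewrite [runs _ _]/= -/(runs e (y :: s)).
have [a [r rE]] := runs_cons e y s; move: IHs; rewrite rE /= => <-.
by case: ifP => _ /=; rewrite ?addSn ?add0n.
Qed.

Definition cuts (a : seq nat) := [seq sumn (take k a) | k <- iota 1 (size a).-1].

Lemma cuts1 a r : cuts (1%N :: a.+1 :: r) = 1%N :: map S (cuts (a.+1 :: r)).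
Proof.
rewrite /cuts /= ?take0 /= ?addn0; congr (_ :: _); rewrite (iotaDl 1 1) -!map_comp.
by apply/eq_in_map => k _ /=; case: k => [|k]; rewrite /= ?add1n.
Qed.

Lemma cutsS a r : cuts (a.+1 :: r) = map S (cuts (a :: r)).
Proof.
rewrite /cuts /= -map_comp; apply/eq_in_map => -[|k]; first by rewrite mem_iota.
by rewrite /= addSn.
Qed.

(** Partial sums of run lengths mark the places where adjacent letters are unrelated, so refinement
    becomes an inclusion between sets of positions. *)
Lemma cuts_runs e s :
  cuts (runs e s) =
  [seq k.+1 | k <- iota 0 (size s).-1 & ~~ e (nth x0 s k) (nth x0 s k.+1)].
Proof.
elim: s => [|x [|y s] IHs] //; rewrite [runs _ _]/= -/(runs e (y :: s)).
have [a [r rE]] := runs_cons e y s; move: IHs; rewrite rE => IHs.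
rewrite -[size _]/(size s).+2 [(size s).+2.-1]/= [iota 0 _]/= (iotaDl 1 0).
rewrite [filter _ _]/= filter_map.
have E : [seq k.+1 | k <- [seq addn 1 k | k <- iota 0 (size s) &
    preim (addn 1) (fun k => ~~ e (nth x0 [:: x, y & s] k)
      (nth x0 [:: x, y & s] k.+1)) k]] = map S (cuts (a.+1 :: r)).
  by rewrite IHs -!map_comp.
case: ifP => exy; [rewrite [head _ _]/= [behead _]/= cutsS -E | rewrite cuts1 -E];
  by [].
Qed.

End RunLengths.

Lemma run_lengthsE s : run_lengths s = runs ltn s.
Proof.
elim: s => [|x [|y s] IHs] //.
by rewrite [LHS]/= -/(run_lengths (y :: s)) IHs.
Qed.

(** Equal letters of a sorted word are adjacent, so each run of equal letters is the full
    multiplicity of one variable. *)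
Lemma exponents_mon s : sorted leq s -> exponents (mon s) = runs eq_op s.
Proof.
move=> ss; have -> : exponents (mon s) = [seq count_mem i s | i <- undup s].
  rewrite /exponents (eq_map (monE s)); congr map.
  apply: (irr_sorted_eq ltn_trans ltnn).
  - by rewrite ltn_sorted_uniq_leq sort_uniq fset_uniq sort_sorted //; exact: leq_total.
  - by rewrite ltn_sorted_uniq_leq undup_uniq undup_sorted //; exact: leq_trans.
  - move=> i; rewrite mem_sort mem_undup -cmE_neq0 monE -has_pred1 has_count.
    by rewrite lt0n.
elim: s ss => [|x [|y s] IHs] //; first by rewrite /= eqxx.
move=> ss; have [xy ys] : (x <= y)%N /\ path leq y s by case/andP: ss.
have IH := IHs ys; rewrite [runs _ _]/= -/(runs eq_op (y :: s)) -IH.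
have Hx : x != y -> x \notin y :: s.
  move=> nxy; apply/negP => xs; move: ys; rewrite path_sortedE; last exact: leq_trans.
  case/andP => /allP ys _; move: xs; rewrite in_cons (negbTE nxy) => /ys yx.
  by rewrite eqn_leq xy yx in nxy.
rewrite [undup _]/= -/(undup (y :: s)).
have cnt : {in undup (y :: s), forall i, i != x ->
    count_mem i [:: x, y & s] = count_mem i (y :: s)}.
  by move=> i _ /negbTE ix; rewrite [LHS]/= eq_sym ix.
case: eqVneq Hx cnt => [xy' _ cnt|nxy /(_ isT) Hx cnt]; last first.
  rewrite (negbTE Hx) [map _ (_ :: _)]/= eqxx add1n.
  have /= -> := count_memPn Hx; congr (_ :: _).
  apply/eq_in_map => i iu; apply: cnt => //; apply: contraNneq Hx => <-.
  by rewrite -mem_undup.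
rewrite {x}xy' [_ \in _]/= mem_head in ss IHs xy cnt *.
have : sorted ltn (undup (y :: s)).
  by rewrite ltn_sorted_uniq_leq undup_uniq undup_sorted //; exact: leq_trans.
have : y \in undup (y :: s) by rewrite mem_undup mem_head.
have : {subset undup (y :: s) <= y :: s} by move=> i; rewrite mem_undup.
case: (undup _) cnt => // z u cnt sub yu /= zu.
(* The head letter [y] is the least, so it also leads the deduplicated word; repeating it once more
   raises only the first count. *)
have zy : z = y.
  move: (sub z (mem_head _ _)) yu; rewrite !in_cons (eq_sym y z).
  case: eqVneq => //= _ zs yu.
  have : (z < y)%N.
    move: zu; rewrite path_sortedE; last exact: ltn_trans.
    by case/andP=> /allP/(_ _ yu).
  move: ys; rewrite path_sortedE; last exact: leq_trans.
  by case/andP => /allP/(_ _ zs); rewrite leqNgt => /negbTE->.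
rewrite {z}zy in cnt sub yu zu *; rewrite /= eqxx; congr (_ :: _).
apply/eq_in_map => i iu; rewrite -[RHS]cnt //= ?in_cons ?iu ?orbT //.
apply: contraTneq zu => <-; rewrite path_sortedE; last exact: ltn_trans.
by apply/negP=> /andP[/allP/(_ _ iu)]; rewrite /= ltnn.
Qed.

Lemma sum_pred1 (T : eqType) (r : seq T) (P : pred T) x : uniq r ->
  \sum_(y <- r | P y) (x == y)%:R = ((x \in r) && P x)%:R :> int.
Proof.
elim: r => [|y r IHr]; first by rewrite big_nil.
rewrite big_cons in_cons => /andP[yr /IHr->]; case: eqVneq => [->|_] /=.
  by rewrite (negbTE yr) addr0; case: (P y).
by rewrite add0r; case: (P y).
Qed.

Lemma fps_sumE (I : Type) (r : seq I) (P : pred I) (F : I -> fps) m :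
  (\sum_(i <- r | P i) F i) m = \sum_(i <- r | P i) F i m.
Proof. by elim/big_rec2: _ => // i y1 y2 _ <-. Qed.

Lemma fps_muln (f : fps) n m : (f *+ n) m = f m *+ n.
Proof. by elim: n => [|n IHn] //; rewrite !mulrS -IHn. Qed.

Lemma fps_mulz (f : fps) z m : (f *~ z) m = f m *~ z.
Proof. by case: z => n; rewrite /intmul /= fps_muln. Qed.

Definition ascent (p : seq nat) k := (nth 0 p k < nth 0 p k.+1)%N.

(** The monomial occurs in a single [Mfun b], the one for its exponents, and [b] refines
    [descent_comp p] exactly when the lengths agree and [s] rises strictly at every descent of
    [p]. *)
Lemma Lfun_mon (p s : seq nat) : sorted leq s ->
  Lfun (descent_comp p) (mon s) =
  ((size p == size s) &&
   all (fun k => (nth 0 s k == nth 0 s k.+1) ==> ascent p k) (iota 0 (size p).-1))%:R.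
Proof.
move=> ss; have Es : all (ltn 0%N) (exponents (mon s)).
  by rewrite exponents_mon // runs_gt0.
pose E := Composition Es; rewrite /Lfun fps_sumE.
have wE : weight E = size s by rewrite /weight /= exponents_mon // sumn_runs.
have wp : weight (descent_comp p) = size p by rewrite /weight /= run_lengthsE sumn_runs.
rewrite (eq_bigr (fun b => (E == b)%:R)) // sum_pred1 ?compositions_uniq //.
rewrite mem_compositions /refines wE wp eq_sym andbA andbb; case: eqP => //= sps.
rewrite /psums /= -![[seq sumn _ | _ <- _]]/(cuts _) run_lengthsE exponents_mon //.
rewrite !(cuts_runs 0%N) all_map; congr (nat_of_bool _)%:R.
rewrite -sps all_filter; apply: eq_in_all => k; rewrite mem_iota => kp /=.
rewrite mem_map; last exact: succn_inj.
by rewrite mem_filter mem_iota kp andbT implybNN.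
Qed.

(** * P-partitions *)

Definition monf (T : finType) (h : T -> nat) := mon [seq h x | x <- enum T].

Section Labeling.
Variables (P : lposet) (T : finType) (lab : T -> nat) (r : rel T).
Hypotheses (lab_inj : injective lab)
  (labP : perm_eq (labels P) [seq lab x | x <- enum T])
  (labr : forall x y, plt P (lab x) (lab y) = r x y).

Definition linear_ext (t : seq T) :=
  [forall x, forall y, r x y ==> (index x t < index y t)%N].

(** Passes from words of labels to words of points of a finite type [T], so that a convenient model
    of the poset can be chosen later. *)
Lemma linexts_perm :
  perm_eq (linexts P)
    [seq map lab t | t <- permutations (enum T) & linear_ext t].
Proof.
have lin t : t \in permutations (enum T) ->
    is_linext P (map lab t) = linear_ext t.
  move=> _; apply/allrelP/forallP => [H x|H u v].
    apply/forallP => y; rewrite -labr -(index_map lab_inj) -(index_map lab_inj t).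
    by apply: H; rewrite (perm_mem labP) map_f ?mem_enum.
  rewrite !(perm_mem labP) => /mapP[x _ ->] /mapP[y _ ->].
  by rewrite labr !index_map //; exact/(forallP (H x)).
apply: uniq_perm.
- by rewrite filter_uniq // permutations_uniq.
- rewrite map_inj_in_uniq ?filter_uniq ?permutations_uniq //.
  by move=> t u _ _; apply: inj_map.
move=> p; rewrite mem_filter mem_permutations; apply/andP/mapP => [[pl pp]|].
  have [t pt] : exists t, p = map lab t.
    have: {subset p <= [seq lab x | x <- enum T]}.
      by move=> x; rewrite -(perm_mem labP) (perm_mem pp).
    elim: p {pl pp} => [|y p IHp] sub; first by exists [::].
    have [z zp|t ->] := IHp; first by apply: sub; rewrite in_cons zp orbT.
    by have /mapP[x _ ->] := sub y (mem_head _ _); exists (x :: t).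
  have tP : t \in permutations (enum T).
    rewrite mem_permutations; apply: (perm_map_inj lab_inj).
    by rewrite -pt; apply: perm_trans labP.
  by exists t => //; rewrite mem_filter -lin // -pt pl.
case=> t; rewrite mem_filter => /andP[tl tP] ->; rewrite lin //; split=> //.
rewrite perm_sym; apply: perm_trans labP _; rewrite perm_sym perm_map //.
by rewrite -mem_permutations.
Qed.

(** Ties in value are broken by label; sorting the points this way recovers the one linear extension
    to which a P-partition belongs. *)
Definition lexle (h : T -> nat) x y :=
  (h x < h y)%N || (h x == h y) && (lab x <= lab y)%N.
Definition lexlt (h : T -> nat) x y :=
  (h x < h y)%N || (h x == h y) && (lab x < lab y)%N.

Lemma lexle_trans h : transitive (lexle h).
Proof. by move=> y x z; rewrite /lexle; lia. Qed.

Lemma lexle_total h : total (lexle h).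
Proof. by move=> x y; rewrite /lexle; lia. Qed.

Lemma lexle_anti h : antisymmetric (lexle h).
Proof. by move=> x y; rewrite /lexle => H; apply: lab_inj; lia. Qed.

Lemma lexltE h x y : lexlt h x y = ~~ lexle h y x.
Proof. by rewrite /lexlt /lexle; lia. Qed.

Let lsort h := sort (lexle h) (enum T).

Lemma perm_lsort h : perm_eq (lsort h) (enum T).
Proof. by rewrite perm_sort. Qed.

Lemma linear_ext_sort h :
  linear_ext (lsort h) = [forall x, forall y, r x y ==> lexlt h x y].
Proof.
have sS : sorted (lexle h) (lsort h) := sort_sorted (lexle_total h) _.
apply: eq_forallb => x; apply: eq_forallb => y; congr (_ ==> _).
have inS z : z \in lsort h by rewrite mem_sort mem_enum.
rewrite lexltE ltnNge; congr (~~ _); apply/idP/idP => H.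
  apply: (sorted_leq_index (@lexle_trans h) _ sS _ _ (inS y) (inS x) H) => z.
  by rewrite /lexle; lia.
rewrite leqNgt; apply/negP => xy.
have /andP := conj H (sorted_ltn_index (@lexle_trans h) sS _ _ (inS x) (inS y) xy).
by rewrite andbC => /lexle_anti yx; rewrite yx ltnn in xy.
Qed.

(** Between adjacent points of equal value the labels must ascend, which is the condition under
    which [Lfun_mon] gives coefficient 1. *)
Lemma sorted_lexle h t : uniq t ->
  sorted (lexle h) t =
  sorted leq [seq h x | x <- t] &&
  all (fun k => (nth 0 [seq h x | x <- t] k == nth 0 [seq h x | x <- t] k.+1) ==>
    ascent [seq lab x | x <- t] k) (iota 0 (size t).-1).
Proof.
elim: t => [|x [|y t] IHt] // /andP[xt ut].
rewrite [LHS]/= -/(sorted (lexle h) (y :: t)) (IHt ut).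
rewrite -[(size (x :: _)).-1]/(size t).+1 [iota 0 _.+1]/= (iotaDl 1 0).
rewrite [all _ (_ :: _)]/= all_map; set v := all _ _.
rewrite /= -/(path leq (h y) _); set u := path _ _ _.
have : lab x != lab y by apply: contraNneq xt => /lab_inj->; rewrite mem_head.
by rewrite /ascent /= /lexle; case: u v => [] []; lia.
Qed.

(** The fundamental theorem of P-partitions, one monomial at a time: each P-partition is counted at
    the linear extension obtained by sorting it. Bounding the letters by [K] makes the sum over maps
    finite. *)
Lemma qsymF_mon K s : sorted leq s -> all (gtn K.+1) s ->
  qsymF P (mon s) = \sum_(h : {ffun T -> 'I_K.+1})
    ((monf (fun x => h x : nat) == mon s) &&
     [forall x, forall y, r x y ==> lexlt (fun x => h x : nat) x y])%:R.
Proof.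
move=> ss sK; pose H (h : {ffun T -> 'I_K.+1}) x : nat := h x.
rewrite /qsymF fps_sumE (perm_big _ linexts_perm) big_map big_filter /=.
under [RHS]eq_bigr => h _.
  rewrite -linear_ext_sort -/(H h).
  have -> : ((monf (H h) == mon s) && linear_ext (lsort (H h)))%:R =
      \sum_(t <- permutations (enum T) | linear_ext t)
        ((monf (H h) == mon s) && (lsort (H h) == t))%:R :> int.
    under eq_bigr do rewrite -mulnb natrM.
    rewrite -mulr_sumr sum_pred1 ?permutations_uniq // mem_permutations perm_lsort.
    by rewrite -natrM mulnb.
  over.
rewrite exchange_big /= big_seq_cond [RHS]big_seq_cond; apply: eq_bigr => t /andP[].
rewrite mem_permutations => tT _; rewrite Lfun_mon //.
have ut : uniq t by rewrite (perm_uniq tT) enum_uniq.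
(* Once [t] is fixed, only one map can have sorted order [t] and values [s]: it sends the k-th point
   of [t] to the k-th letter of [s]. The bound [sK] keeps [inord] faithful. *)
pose h0 : {ffun T -> 'I_K.+1} := [ffun x => inord (nth 0%N s (index x t))].
set c := (X in (nat_of_bool X)%:R).
transitivity (\sum_(h : {ffun T -> 'I_K.+1} | c) (h0 == h)%:R : int).
  by rewrite sum_pred1 ?index_enum_uniq // mem_index_enum.
rewrite big_mkcond; apply: eq_bigr => h _.
have monh : (monf (H h) == mon s) = perm_eq [seq H h x | x <- t] s.
  rewrite eq_mon -/(H h); 
  have /permPl -> // : perm_eq [seq H h x | x <- enum T] [seq H h x | x <- t].
  by rewrite perm_map // perm_sym.
suff -> : (monf (H h) == mon s) && (lsort (H h) == t) = c && (h0 == h) by case: c.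
rewrite monh; apply/andP/andP => [[hs /eqP tE]|[cT /eqP hE]].
  have := sort_sorted (lexle_total (H h)) (enum T); rewrite -/(lsort _) tE.
  rewrite sorted_lexle // => /andP[st at_].
  have sE := sorted_eq leq_trans anti_leq st ss hs.
  rewrite /c -sE !size_map eqxx; split=> //.
  apply/eqP/ffunP => x; rewrite ffunE -sE; apply/val_inj.
  have xt : x \in t by rewrite (perm_mem tT) mem_enum.
  by rewrite (nth_map x) ?index_mem // nth_index //= inord_val.
have sE : [seq H h x | x <- t] = s.
  have /andP[/eqP szt _] := cT; rewrite size_map in szt.
  apply: (@eq_from_nth _ 0%N) => [|k]; rewrite size_map // => kt.
  have x0 : T by case: (t) kt.
  rewrite (nth_map x0) // /H -hE /h0 ffunE index_uniq // inordK //.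
  by apply: (allP sK); rewrite mem_nth // -szt.
split; first by rewrite sE.
apply/eqP/(sorted_eq (@lexle_trans (H h)) (@lexle_anti (H h))).
- exact/sort_sorted/lexle_total.
- by rewrite sorted_lexle // sE ss; have /andP[_] := cT; rewrite size_map.
- by rewrite (perm_trans (perm_lsort _)) // perm_sym.
Qed.

End Labeling.

(** * The labeled posets of compositions *)

Lemma mem_antichain k n x : (x \in labels (antichain k n)) = (k < x <= k + n)%N.
Proof. by rewrite !inE /= mem_iota addSn ltnS. Qed.

Lemma mem_osums (r : seq nat) (F : nat -> lposet) x :
  (x \in labels (\big[osum/antichain 0 0]_(i <- r) F i)) =
  has (fun i => x \in labels (F i)) r.
Proof.
elim: r => [|i r IHr]; first by rewrite big_nil mem_antichain; case: x.
by rewrite big_cons inE IHr.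
Qed.

(** Disjointness of the blocks matters, since [osum] gives a shared label to its left summand
    only. *)
Lemma plt_osums (r : seq nat) (k n : nat -> nat) i j x y :
    let F i := antichain (k i) (n i) in
    sorted ltn r -> {in r &, forall i j, forall x,
      x \in labels (F i) -> x \in labels (F j) -> i = j} ->
    i \in r -> j \in r -> x \in labels (F i) -> y \in labels (F j) ->
  plt (\big[osum/antichain 0 0]_(i <- r) F i) x y = (i < j)%N.
Proof.
move=> F; elim: r => // h r IHr sr disj ir jr xi yj; rewrite big_cons.
have memh l z : l \in h :: r -> z \in labels (F l) -> (z \in labels (F h)) = (l == h).
  move=> lr zl; apply/idP/eqP => [zh|<- //].
  exact: (disj _ _ lr (mem_head _ _) z).
have lth l : l \in r -> (h < l)%N.
  move=> lr; move: sr; rewrite /= path_sortedE; last exact: ltn_trans.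
  by case/andP=> /allP/(_ _ lr).
have IH := IHr (path_sorted sr).
rewrite /plt /= (memh _ _ ir xi) (memh _ _ jr yj).
move: ir jr; rewrite !in_cons.
case: eqVneq => [ih _|_ /= ir]; case: eqVneq => [jh _|njh /= jr].
- by rewrite ih jh ltnn; case: eqP.
- rewrite ih lth //= andbT; apply: contraNneq njh => xy.
  by rewrite -(memh _ y) ?in_cons ?jr ?orbT // -xy -ih.
- by rewrite jh ltnNge ltnW ?lth //= andbF.
rewrite -[RHS](IH _ ir jr xi yj) // => l l' lr lr'.
by apply: disj; rewrite in_cons ?lr ?lr' orbT.
Qed.

Section Blocks.
Variable a : composition.

Definition in_block i x := (block_start a i < x <= block_start a i + nth 0 a i)%N.

Lemma sum_disjoint (p : pred nat) i j : (i < j)%N -> p i ->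
  (\sum_(l < i | p l) nth 0 a l + nth 0 a i <= \sum_(l < j | p l) nth 0 a l)%N.
Proof.
move=> ij pi; rewrite -!(big_mkord p) [leqRHS](@big_cat_nat _ _ _ i.+1) //=.
by rewrite [X in (_ <= X + _)%N]big_mkcond big_nat_recr //= pi -big_mkcond leq_addr.
Qed.

(** Odd-indexed blocks are labeled first, and blocks of equal parity in order, so labels go down
    only from an even-indexed block to a later odd-indexed one. *)
Lemma block_lt i j x y : (i < j < size a)%N -> in_block i x -> in_block j y ->
  if odd i || ~~ odd j then (x < y)%N else (y < x)%N.
Proof.
rewrite /in_block /block_start => /andP[ij ja].
have ia := ltn_trans ij ja.
have := @sum_disjoint odd i j ij; have := @sum_disjoint (fun i => ~~ odd i) i j ij.
have := @sum_disjoint odd _ _ ja; have := @sum_disjoint odd _ _ ia.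
by case: (odd i); case: (odd j) => /=; lia.
Qed.

Lemma in_block_inj i j x : (i < size a)%N -> (j < size a)%N ->
  in_block i x -> in_block j x -> i = j.
Proof.
move=> ia ja xi xj; case: (ltngtP i j) => // ij.
  by have := @block_lt i j x x; rewrite ij ja ltnn if_same => /(_ isT xi xj).
by have := @block_lt j i x x; rewrite ij ia ltnn if_same => /(_ isT xj xi).
Qed.

Lemma comp_posetE : comp_poset a =
  \big[osum/antichain 0 0]_(i <- iota 0 (size a))
    antichain (block_start a i) (nth 0%N a i).
Proof.
rewrite /comp_poset.
pose F i := antichain (block_start a i) (nth 0%N a i).
by rewrite -(big_mkord xpredT F) /index_iota subn0.
Qed.

Lemma mem_comp_poset x :
  (x \in labels (comp_poset a)) = has (in_block^~ x) (iota 0 (size a)).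
Proof. by rewrite comp_posetE mem_osums; apply: eq_has => i; rewrite mem_antichain. Qed.

Lemma plt_comp_poset i j x y : (i < size a)%N -> (j < size a)%N ->
  in_block i x -> in_block j y -> plt (comp_poset a) x y = (i < j)%N.
Proof.
move=> ia ja xi yj; rewrite comp_posetE (@plt_osums _ _ _ i j);
  rewrite ?iota_ltn_sorted ?mem_iota ?mem_antichain //.
move=> l l'; rewrite !mem_iota /= => la la' z; rewrite !mem_antichain.
exact: in_block_inj.
Qed.

Section Labels.
Variables (T : finType) (b : T -> nat).
Hypothesis fibb : forall i, #|[pred x | b x == i]| = nth 0%N a i.

(** Any [b] with the right fibre sizes models the poset. The order of labels inside a fibre is an
    arbitrary choice, as the fibre is an antichain. *)
Definition block_label x :=
  (block_start a (b x) + (index x (enum [pred y | b y == b x])).+1)%N.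

Lemma block_label_in x : in_block (b x) (block_label x).
Proof.
rewrite /in_block /block_label -fibb cardE addnS ltnS leq_addr /=.
by rewrite -addnS leq_add2l index_mem mem_enum inE.
Qed.

Lemma block_lt_size x : (b x < size a)%N.
Proof.
rewrite ltnNge; apply/negP => bx; have := fibb (b x); rewrite nth_default //.
by move/eqP; apply/negP; rewrite -lt0n; apply/card_gt0P; exists x; rewrite inE.
Qed.

Lemma block_label_inj : injective block_label.
Proof.
move=> x y xy; have := block_label_in y; rewrite -xy.
move/(in_block_inj (block_lt_size x) (block_lt_size y) (block_label_in x)) => bxy.
move: xy; rewrite /block_label bxy => /addnI[].
by apply: (index_inj x); rewrite mem_enum inE ?bxy.
Qed.

Lemma block_label_perm :
  perm_eq (labels (comp_poset a)) [seq block_label x | x <- enum T].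
Proof.
apply: uniq_perm; first exact: fset_uniq.
  by rewrite (map_inj_uniq block_label_inj) enum_uniq.
move=> l; rewrite mem_comp_poset; apply/hasP/mapP => [[i]|[x _ ->]]; last first.
  by exists (b x); rewrite ?block_label_in // mem_iota block_lt_size.
rewrite mem_iota /in_block => ia /andP[il li].
have lt : (l - (block_start a i).+1 < size (enum [pred y | b y == i]))%N.
  by rewrite -cardE fibb; lia.
have x0 : T by case: (enum [pred y | b y == i]) lt.
have := mem_nth x0 lt; rewrite mem_enum inE => /eqP bE.
exists (nth x0 (enum [pred y | b y == i]) (l - (block_start a i).+1)).
  by rewrite mem_enum.
by rewrite /block_label bE index_uniq ?enum_uniq //; lia.
Qed.

Lemma plt_block_label x y :
  plt (comp_poset a) (block_label x) (block_label y) = (b x < b y)%N.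
Proof. by rewrite (@plt_comp_poset (b x) (b y)) ?block_lt_size ?block_label_in. Qed.

Lemma block_label_lt x y : (b x < b y)%N ->
  (block_label x < block_label y)%N = odd (b x) || ~~ odd (b y).
Proof.
move=> xy; have := @block_lt _ _ _ _ _ (block_label_in x) (block_label_in y).
rewrite xy block_lt_size => /(_ isT); case: ifP => // _ yx.
by apply/negbTE; rewrite -leqNgt ltnW.
Qed.

End Labels.
End Blocks.

(** * Gapless block structures *)

(** Here [b] gives block indices and [z] positions in the order of coloured values. Only blocks of
    opposite parity are compared, which is enough when no block in between is empty. *)
Definition separates (T : finType) (b z : T -> nat) :=
  [forall x, forall y,
    (b x < b y)%N && (odd (b x) != odd (b y)) ==> (z x < z y)%N].

Lemma separatesP (T : finType) (b z : T -> nat) :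
  reflect (forall x y, (b x < b y)%N -> odd (b x) != odd (b y) -> (z x < z y)%N)
          (separates b z).
Proof.
apply: (iffP forallP) => [H x y bxy oxy|H x].
  by have /forallP/(_ y) := H x; rewrite bxy oxy.
by apply/forallP => y; apply/implyP => /andP[bxy oxy]; exact: H.
Qed.

(* The rank of (h x, colour) in (0, blue) < (0, red) < (1, blue) < (1, red) < ...;
   as blocks are indexed from 0, odd ones are blue. *)
Definition zpos (T : Type) (c : T -> bool) (h : T -> nat) x := ((h x).*2 + ~~ c x)%N.

Lemma block_inhabited (a : composition) (T : finType) (b : T -> nat) i :
  (forall i, #|[pred x | b x == i]| = nth 0%N a i) -> (i < size a)%N ->
  exists x, b x = i.
Proof.
move=> fibb ia; have : (0 < nth 0 a i)%N.
  exact: (allP (parts_gt0 a) _ (mem_nth _ ia)).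
by rewrite -fibb => /card_gt0P[x /eqP]; exists x.
Qed.

(** Equal values are allowed from an odd to a later even block and forbidden from an even to a later
    odd one, as the labels dictate; the colour bit in [zpos] encodes just this. *)
Lemma Nfun_mon (a : composition) (T : finType) (b : T -> nat) K s :
    (forall i, #|[pred x | b x == i]| = nth 0%N a i) ->
    sorted leq s -> all (gtn K.+1) s ->
  Nfun a (mon s) = \sum_(h : {ffun T -> 'I_K.+1})
    ((monf (fun x => h x : nat) == mon s) &&
     separates b (zpos (fun x => odd (b x)) (fun x => h x : nat)))%:R.
Proof.
move=> fibb ss sK; rewrite /Nfun.
rewrite (qsymF_mon (block_label_inj fibb) (block_label_perm fibb)
  (plt_block_label fibb) ss sK).
apply: eq_bigr => h _; congr (nat_of_bool (_ && _))%:R.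
have key x y : (b x < b y)%N -> odd (b x) != odd (b y) ->
    lexlt (block_label a b) (fun x => h x : nat) x y =
    (zpos (fun x => odd (b x)) (fun x => h x : nat) x <
     zpos (fun x => odd (b x)) (fun x => h x : nat) y)%N.
  move=> bxy; rewrite /lexlt /zpos (block_label_lt fibb) //.
  by case: (odd (b x)); case: (odd (b y)) => //= _; lia.
apply/forallP/separatesP => [H x y bxy oxy|/= H x].
  by rewrite -key //; have /forallP/(_ y) := H x; rewrite bxy.
apply/forallP => y; apply/implyP => bxy.
have [oxy|oxy] := boolP (odd (b x) != odd (b y)); first by rewrite key ?H.
have bxy' : ((b x).+1 < b y)%N.
  by rewrite ltn_neqAle bxy andbT; apply: contraNneq oxy => <- /=; case: odd.
(* Blocks of equal parity are not consecutive, so a point [w] of the next block links [x] to [y] by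
   two comparisons of opposite colours. *)
have [|w bw] := @block_inhabited _ _ _ (b x).+1 fibb.
  exact: ltn_trans bxy' (block_lt_size fibb y).
have := H x w; have := H w y; rewrite bw /= bxy' ltnSn /lexlt (block_label_lt fibb) //.
rewrite /zpos bw /=; move: oxy; case: (odd (b x)); case: (odd (b y)) => //= _.
  by move=> /(_ isT isT) ? /(_ isT isT) ?; lia.
by move=> /(_ isT isT) ? /(_ isT isT) ?; lia.
Qed.

Section Gapless.
Variables (T : finType).
Implicit Types (b z : T -> nat) (c : T -> bool).

Definition gapless c b :=
  [forall x, odd (b x) == c x] &&
  [forall x, (0 < b x)%N ==> [exists y, (b y).+1 == b x]].

Lemma gaplessP c b :
  reflect ((forall x, odd (b x) = c x) /\
           (forall x i, b x = i.+1 -> exists y, b y = i))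
          (gapless c b).
Proof.
apply: (iffP andP) => [[/forallP co /forallP H]|[co H]].
  split=> [x|x i bx]; first exact/eqP.
  by have := H x; rewrite bx => /existsP[y /eqP[<-]]; exists y.
split; apply/forallP => x; rewrite ?co //; apply/implyP; case E: (b x) => [|i] // _.
by have [y <-] := H _ _ E; apply/existsP; exists y.
Qed.

Lemma gapless_attained c b x k : gapless c b -> (k <= b x)%N -> exists y, b y = k.
Proof.
case/gaplessP => _ H; elim: {x}_.+1 {-2}x (ltnSn (b x)) => // n IHn x bn.
rewrite leq_eqVlt => /predU1P[->|]; first by exists x.
case E: (b x) => [|i] // ki; have [y yi] := H _ _ E.
by apply: (IHn y); rewrite yi // -ltnS -E.
Qed.

(** All indices up to [b x] are attained by distinct points. The bound allows summing over block
    maps as finite functions. *)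
Lemma gapless_bound c b x : gapless c b -> (b x < #|T|)%N.
Proof.
move=> bc; rewrite cardE -(size_map b) -(size_iota 0%N (b x).+1).
apply: uniq_leq_size (iota_uniq _ _) _ => k; rewrite mem_iota ltnS => kb.
by have [y <-] := gapless_attained bc kb; rewrite map_f ?mem_enum.
Qed.

(** Descend one block at a time: if [x] has index [i.+1], some [y] of index [i] has the other colour
    and smaller [z]. A second separating map must then put [x] strictly after [y], so by induction
    its index at [x] is at least as large; symmetry concludes. *)
Lemma gapless_unique c z b b' : gapless c b -> gapless c b' ->
  separates b z -> separates b' z -> b =1 b'.
Proof.
have le b1 b2 : gapless c b1 -> gapless c b2 ->
    separates b1 z -> separates b2 z -> forall x, (b1 x <= b2 x)%N.
  move=> /gaplessP[c1 H] /gaplessP[c2 _] /separatesP s1 /separatesP s2 x.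
  elim: {x}_.+1 {-2}x (ltnSn (b1 x)) => // n IHn x bn.
  case E: (b1 x) => [|i] //; have [y yi] := H _ _ E.
  have zyx : (z y < z x)%N by apply: s1; rewrite E yi //=; case: odd.
  have cyx : c y != c x by rewrite -!c1 E yi /=; case: odd.
  have byn : (b1 y < n)%N by rewrite yi; lia.
  have := IHn y byn; rewrite yi => /leq_ltn_trans; apply.
  rewrite ltn_neqAle leqNgt; apply/andP; split.
    by apply: contraNneq cyx => e; rewrite -!c2 e.
  by apply/negP => /s2; rewrite !c2 eq_sym => /(_ cyx); rewrite ltnNge ltnW.
move=> g g' s s' x; apply/eqP; rewrite eqn_leq.
by rewrite (le _ _ g g') // (le _ _ g' g).
Qed.

(** The height of [x] is the length of the longest colour-alternating chain below it in [z]; its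
    level sets will be the monochromatic runs. The recursion is made structural by fuel, and any
    fuel above [z x] gives the same value. *)
Lemma height_exists c z : exists b : T -> nat, forall x,
  b x = \max_(y | (c y != c x) && (z y < z x)%N) (b y).+1.
Proof.
pose fix rk n x {struct n} := if n is n'.+1 then
  \max_(y | (c y != c x) && (z y < z x)%N) (rk n' y).+1 else 0%N.
have rkE n n' x : (z x < n)%N -> (z x < n')%N -> rk n x = rk n' x.
  elim: n n' x => [|n IHn] [|n'] x //= xn xn'; apply: eq_bigr => y /andP[_ yx].
  by rewrite (IHn n') //; apply: leq_trans yx _.
exists (fun x => rk (z x).+1 x) => x /=; apply: eq_bigr => y /andP[_ yx].
by rewrite (rkE _ (z y).+1) //.
Qed.

(** The height works as block map. The second hypothesis makes the lowest run one of colour [false],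
    so that the parity of the height is the colour. *)
Lemma gapless_exists c z : (forall x y, z x = z y -> c x = c y) ->
    (forall y, c y -> exists2 x, ~~ c x & (z x < z y)%N) ->
  exists2 b : T -> nat, gapless c b & separates b z.
Proof.
move=> zc H; have [b bE] := height_exists c z.
have bP x : (b x = 0%N /\ ~~ c x) \/
    exists y, [/\ c y != c x, (z y < z x)%N & b x = (b y).+1].
  pose p := [pred y | (c y != c x) && (z y < z x)%N].
  rewrite bE; have [/pred0P p0|ne] := boolP (pred0b p).
    left; rewrite big_pred0 //; split=> //; apply/negP => cx.
    by have [y cy yx] := H x cx; have := p0 y; rewrite /= (negbTE cy) cx yx.
  right; have [|y /andP[cyx yx] ->] := @eq_bigmax_cond _ p (fun y => (b y).+1).
    by rewrite lt0n.
  by exists y.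
have bc x : odd (b x) = c x.
  elim: {x}_.+1 {-2}x (ltnSn (z x)) => // n IHn x xn.
  have [[-> /negbTE->] //|[y [cyx yx ->]]] := bP x.
  by rewrite /= IHn ?(leq_trans yx) //; move: cyx; case: (c x); case: (c y).
exists b.
  apply/gaplessP; split=> // x i bx; have [[]|[y [_ _]]] := bP x; rewrite bx //.
  by case=> ->; exists y.
apply/separatesP => x y bxy; rewrite !bc => oxy; rewrite ltnNge leq_eqVlt.
apply/negP => /predU1P[/zc e|yx]; first by rewrite e eqxx in oxy.
suff : (b y < b x)%N by rewrite ltnNge ltnW.
rewrite (bE x); apply: (leq_bigmax_cond (F := fun y => (b y).+1)).
by rewrite yx andbT eq_sym.
Qed.

(** Points of opposite colours tie neither in [b] nor in [z], so the one-way implication of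
    separation reverses. This moves the constraints of each factor from values to merged blocks. *)
Lemma gapless_separates c z b x y : (forall x y, z x = z y -> c x = c y) ->
    gapless c b -> separates b z -> c x != c y ->
  (z x < z y)%N = (b x < b y)%N.
Proof.
move=> zc /gaplessP[bc _] /separatesP s cxy; apply/idP/idP; last first.
  by move/s; rewrite !bc; apply.
move=> zxy; rewrite ltnNge leq_eqVlt; apply/negP => /predU1P[e|/s].
  by rewrite -!bc e eqxx in cxy.
by rewrite !bc eq_sym cxy => /(_ isT); rewrite ltnNge ltnW.
Qed.

(** Existence and uniqueness of the separating gapless map, packed as an identity of indicators: one
    term of the sum is 1 if [Q] holds, and none otherwise. *)
Lemma sum_gapless c z (P : pred (T -> nat)) (Q : bool) :
    (forall b b', b =1 b' -> P b = P b') ->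
    (forall b, gapless c b -> separates b z -> P b = Q) ->
    (Q -> exists2 b, gapless c b & separates b z) ->
  Q%:R = \sum_(b : {ffun T -> 'I_#|T|} |
     gapless c (fun x => b x : nat) && P (fun x => b x : nat))
       (separates (fun x => b x : nat) z)%:R :> int.
Proof.
move=> extP PQ exQ; case: Q PQ exQ => [PQ /(_ isT)[b0 g0 s0]|PQ _]; last first.
  rewrite big1 // => b /andP[gb Pb]; case: separates (PQ _ gb) => // /(_ isT).
  by rewrite Pb.
pose b : {ffun T -> 'I_#|T|} := [ffun x => Ordinal (gapless_bound x g0)].
have bE : (fun x => b x : nat) =1 b0 by move=> x; rewrite ffunE.
have gb : gapless c (fun x => b x : nat).
  have /gaplessP[bc H] := g0; apply/gaplessP.
  split=> [x|x i]; rewrite bE // => /H[y yi].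
  by exists y; rewrite bE.
have sb : separates (fun x => b x : nat) z.
  by apply/separatesP => x y; rewrite !bE; apply/separatesP.
rewrite (bigD1 b) /= ?gb ?PQ // sb big1 ?addr0 // => b' /andP[/andP[gb' _] nbb'].
case s': separates => //; case/eqP: nbb'; apply/ffunP => x; apply/val_inj.
exact: gapless_unique gb' gb s' sb x.
Qed.

(* For a gapless b the filter only drops trailing zeros. *)
Definition fibre_sizes b : composition :=
  Composition (filter_all (ltn 0) [seq #|[pred x | b x == i]| | i <- iota 0%N #|T|]).

(** By the hypothesis only zeros follow a zero, so filtering removes a tail and shifts no index. *)
Lemma nth_filter_pos (s : seq nat) i :
  (forall j, (0 < nth 0 s j.+1)%N -> (0 < nth 0 s j)%N) ->
  nth 0%N (filter (ltn 0) s) i = nth 0%N s i.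
Proof.
elim: s i => [|[|x] s IHs] i H //; last first.
  case: i => [|i] //=; apply: IHs => j; exact: H j.+1.
have s0 j : nth 0%N (0%N :: s) j = 0%N.
  elim: j => // j IHj; apply/eqP; rewrite eqn0Ngt; apply/negP => /H.
  by rewrite IHj.
rewrite s0 (_ : filter _ _ = [::]) ?nth_nil //.
apply/eqP; rewrite -[_ == _]negbK -has_filter; apply/hasPn => x /(nthP 0%N)[j _ <-].
by rewrite s0.
Qed.

Lemma fibre_sizesE c b : gapless c b -> forall i,
  #|[pred x | b x == i]| = nth 0%N (fibre_sizes b) i.
Proof.
move=> g i; have lt j : (0 < #|[pred x | b x == j]|)%N -> (j < #|T|)%N.
  by case/card_gt0P=> x /eqP <-; exact: gapless_bound g.
have nthE j : nth 0%N [seq #|[pred x | b x == i]| | i <- iota 0%N #|T|] j =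
    #|[pred x | b x == j]|.
  have [jT|Tj] := ltnP j #|T|; first by rewrite (nth_map 0%N) ?size_iota ?nth_iota.
  rewrite nth_default ?size_map ?size_iota //; apply/esym/eqP.
  by rewrite eqn0Ngt; apply/negP => /lt; rewrite ltnNge Tj.
rewrite /= nth_filter_pos ?nthE // => j; rewrite !nthE => /card_gt0P[x /eqP bx].
by have /gaplessP[_ /(_ _ _ bx)[y yj]] := g; apply/card_gt0P; exists y; rewrite inE yj.
Qed.

End Gapless.

Lemma rank_fibres (a : composition) (T : finType) (b : T -> nat) :
  (forall i, #|[pred x | b x == i]| = nth 0%N a i) ->
  rank a = #|[pred x | ~~ odd (b x)]|.
Proof.
move=> fibb; rewrite /rank -sum1_card.
pose blk x := Ordinal (block_lt_size fibb x).
rewrite (partition_big blk (fun i => ~~ odd i)) //=.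
apply: eq_bigr => i oi; rewrite -fibb -sum1_card; apply: eq_bigl => x.
by rewrite !inE -val_eqE /=; case: eqP => [->|]; rewrite ?oi ?andbF.
Qed.

(** * Superposition of two block structures *)

Section Product.
Variables (T1 T2 : finType) (b1 : T1 -> nat) (b2 : T2 -> nat).

Definition merged_colour (x : T1 + T2) :=
  match x with inl x => odd (b1 x) | inr y => odd (b2 y) end.

(** The merged block indices play the role of positions for both factors. These maps index the terms
    of the product. *)
Definition shuffle (b : T1 + T2 -> nat) :=
  [&& gapless merged_colour b, separates b1 (b \o inl) & separates b2 (b \o inr)].

Lemma monf_sum (h : T1 + T2 -> nat) :
  monf h = mmul (monf (h \o inl)) (monf (h \o inr)).
Proof.
rewrite /monf -mon_cat; apply/eqP; rewrite eq_mon.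
have /perm_trans-> // : perm_eq [seq h x | x <- enum {: T1 + T2}]
    (map h ([seq inl x | x <- enum T1] ++ [seq inr x | x <- enum T2])).
  apply: perm_map; apply: uniq_perm; rewrite ?enum_uniq //.
    rewrite cat_uniq; apply/and3P; split.
    - by rewrite map_inj_uniq ?enum_uniq // => ? ? [].
    - by apply/hasPn => x /mapP[y _ ->]; apply/mapP => -[].
    - by rewrite map_inj_uniq ?enum_uniq // => ? ? [].
  by case=> x; rewrite mem_enum mem_cat; apply/esym/orP; [left|right];
    rewrite map_f ?mem_enum.
by rewrite map_cat -!map_comp.
Qed.

End Product.

(** * Products *)

Lemma zpos_colour (T : Type) (c : T -> bool) h x y :
  zpos c h x = zpos c h y -> c x = c y.
Proof. by rewrite /zpos; case: (c x); case: (c y) => //=; lia. Qed.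

Lemma sum_mdivs (d e m : {cmonom nat}) :
  \sum_(k <- mdivs m) ((d == k) && (e == divcm m k))%:R = (mmul d e == m)%:R :> int.
Proof.
under eq_bigr do rewrite andbC -mulnb natrM mulr_natl mulrb.
rewrite -big_mkcond sum_pred1 ?fset_uniq //; congr (nat_of_bool _)%:R.
by apply/andP/eqP => [[/mdivsP dm /eqP->] //|/mdivs_mul[-> _ ->]].
Qed.

Section ProductExpansion.
Variables (alpha beta : composition) (T1 T2 : finType).
Variables (b1 : T1 -> nat) (b2 : T2 -> nat).
Hypotheses (fib1 : forall i, #|[pred x | b1 x == i]| = nth 0%N alpha i)
           (fib2 : forall i, #|[pred x | b2 x == i]| = nth 0%N beta i).

Let c1 x := odd (b1 x).
Let c2 x := odd (b2 x).

(** A pair of maps on the two point sets is one map on their disjoint sum, and its monomial is the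
    product of the two. *)
Lemma Nfun_mul_mon K s : sorted leq s -> all (gtn K.+1) s ->
  (Nfun alpha * Nfun beta) (mon s) = \sum_(h : {ffun T1 + T2 -> 'I_K.+1})
    [&& monf (fun x => h x : nat) == mon s,
        separates b1 (zpos c1 (fun x => h (inl x) : nat)) &
        separates b2 (zpos c2 (fun y => h (inr y) : nat))]%:R.
Proof.
move=> ss sK; rewrite [LHS]/=.
pose W1 (f : {ffun T1 -> 'I_K.+1}) := separates b1 (zpos c1 (fun x => f x : nat)).
pose W2 (f : {ffun T2 -> 'I_K.+1}) := separates b2 (zpos c2 (fun x => f x : nat)).
(* Divisors of a monomial involve only its variables, so both factors inherit the bound [K]. *)
have memK d e : mmul d e = mon s ->
    exists2 t, d = mon t & sorted leq t && all (gtn K.+1) t.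
  have [t st ->] := mon_surj d; exists t; rewrite ?st //=.
  apply/allP => i it; apply: (allP sK); rewrite -has_pred1 has_count -monE -H cmM monE.
  by rewrite ltn_addr // -has_count has_pred1.
transitivity (\sum_(k <- mdivs (mon s))
   (\sum_(f : {ffun T1 -> 'I_K.+1}) ((monf (fun x => f x : nat) == k) && W1 f)%:R) *
   (\sum_(g : {ffun T2 -> 'I_K.+1})
      ((monf (fun x => g x : nat) == divcm (mon s) k) && W2 g)%:R) : int).
  rewrite big_seq [RHS]big_seq; apply: eq_bigr => k /mdivsP kE.
  have [t tk /andP[st tK]] := memK _ _ kE.
  have [u uk /andP[su uK]] := memK (divcm (mon s) k) k (etrans (mulmC _ _) kE).
  by rewrite uk {1 2}tk (Nfun_mon fib1 st tK) (Nfun_mon fib2 su uK).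
under eq_bigr do rewrite mulr_suml; rewrite exchange_big /=.
under eq_bigr do under eq_bigr do rewrite mulr_sumr.
under eq_bigr do rewrite exchange_big /=.
rewrite pair_bigA /=.
rewrite (reindex (fun h : {ffun T1 + T2 -> 'I_K.+1} =>
  ([ffun x => h (inl x)] : {ffun T1 -> 'I_K.+1},
   [ffun x => h (inr x)] : {ffun T2 -> 'I_K.+1}))) /=.
  apply: eq_bigr => h _; rewrite monf_sum.
  set f := [ffun x => h (inl x)]; set g := [ffun x => h (inr x)].
  have fE : (fun x => f x : nat) =1 (fun x => h (inl x) : nat).
    by move=> x; rewrite ffunE.
  have gE : (fun x => g x : nat) =1 (fun x => h (inr x) : nat).
    by move=> x; rewrite ffunE.
  transitivity (\sum_(k <- mdivs (mon s)) ((monf (fun x => f x : nat) == k) &&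
      (monf (fun x => g x : nat) == divcm (mon s) k))%:R * (W1 f && W2 g)%:R : int).
    by apply: eq_bigr => k _; rewrite -!natrM !mulnb andbACA.
  rewrite -mulr_suml sum_mdivs -natrM mulnb; congr (nat_of_bool [&& _ == _, _ & _])%:R.
  - by rewrite /monf (eq_map fE) (eq_map gE).
  - by apply/separatesP/separatesP => H x y /H E /E; rewrite /zpos ffunE ffunE.
  - by apply/separatesP/separatesP => H x y /H E /E; rewrite /zpos ffunE ffunE.
exists (fun fg : {ffun T1 -> 'I_K.+1} * {ffun T2 -> 'I_K.+1} =>
    [ffun x : T1 + T2 =>
      match x return 'I_K.+1 with inl x => fg.1 x | inr y => fg.2 y end]).
  by move=> h _; apply/ffunP => -[x|x]; rewrite !ffunE.
by move=> [f g] _; congr (_, _); apply/ffunP => x; rewrite !ffunE.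
Qed.

(** Each admissible superposed map is separated by exactly one gapless block map, which is then a
    shuffle; exchanging the two sums sorts the superposed maps by their shuffle. *)
Lemma Nfun_mul : Nfun alpha * Nfun beta =
  \sum_(b : {ffun T1 + T2 -> 'I_#|{: T1 + T2}|} | shuffle b1 b2 (fun x => b x : nat))
    Nfun (fibre_sizes (fun x => b x : nat)).
Proof.
apply/fpsP => m; have [s ss ->] := mon_surj m.
pose K := \max_(i <- s) i.
have sK : all (gtn K.+1) s.
  by apply/allP => i is_; rewrite /= ltnS /K (big_rem i) //= leq_maxl.
rewrite (Nfun_mul_mon ss sK) fps_sumE.
pose c := merged_colour b1 b2.
transitivity (\sum_(b : {ffun T1 + T2 -> 'I_#|{: T1 + T2}|} |
    shuffle b1 b2 (fun x => b x : nat))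
  \sum_(h : {ffun T1 + T2 -> 'I_K.+1}) ((monf (fun x => h x : nat) == mon s) &&
     separates (fun x => b x : nat) (zpos c (fun x => h x : nat)))%:R : int); last first.
  apply: eq_bigr => b /and3P[g _ _]; rewrite (Nfun_mon (fibre_sizesE g) ss sK).
  have /gaplessP[bc _] := g.
  apply: eq_bigr => h _; congr (nat_of_bool (_ && _))%:R.
  by apply/separatesP/separatesP => H x y /H E /E; rewrite /zpos !bc.
rewrite exchange_big /=; apply: eq_bigr => h _.
case: (_ == mon s); last by rewrite big1.
pose z := zpos c (fun x => h x : nat).
apply: (@sum_gapless _ c z
  (fun b => separates b1 (b \o inl) && separates b2 (b \o inr))).
- move=> b b' bb'; congr (_ && _); apply/separatesP/separatesP => H x y /H E /E /=;
    by rewrite !bb'.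
- move=> b g s0; have zE x y : c x != c y -> (z x < z y)%N = (b x < b y)%N.
    exact: (gapless_separates (@zpos_colour _ c _) g s0).
  rewrite andTb; congr (_ && _); apply/separatesP/separatesP => H x y xy oxy;
    move: (H x y xy oxy) => /=.
  + by rewrite -zE.
  + by rewrite -(zE (inl x) (inl y)).
  + by rewrite -zE.
  + by rewrite -(zE (inr x) (inr y)).
rewrite andTb => /andP[/separatesP s1 /separatesP s2]; apply: gapless_exists.
  exact: zpos_colour.
(* Below a point in an odd block lies a point of block 0 of the same factor, which is nonempty; so
   the lowest run has colour [false]. *)
case=> y /= oy.
  have [|x x0] := @block_inhabited _ _ _ 0%N fib1.
    by apply: leq_trans (block_lt_size fib1 y); rewrite ltnS.
  by exists (inl x); rewrite /= ?x0 //; apply: s1; rewrite x0 ?oy //; case: (b1 y) oy.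
have [|x x0] := @block_inhabited _ _ _ 0%N fib2.
  by apply: leq_trans (block_lt_size fib2 y); rewrite ltnS.
by exists (inr x); rewrite /= ?x0 //; apply: s2; rewrite x0 ?oy //; case: (b2 y) oy.
Qed.

Lemma rank_shuffle b : shuffle b1 b2 b ->
  rank (fibre_sizes b) = (rank alpha + rank beta)%N.
Proof.
case/and3P=> g _ _; have /gaplessP[bc _] := g.
rewrite (rank_fibres (fibre_sizesE g)) (rank_fibres fib1) (rank_fibres fib2).
rewrite -!sum1_card big_mkcond /= big_sumType /= -!big_mkcond.
by congr (_ + _)%N; apply: eq_bigl => x; rewrite !inE bc.
Qed.

End ProductExpansion.

(** * Linear extensions and block words *)

Definition block_word (a : composition) : seq nat :=
  flatten [seq nseq (nth 0%N a i) i | i <- iota 0%N (size a)].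

Lemma count_block_word (a : composition) i : count_mem i (block_word a) = nth 0%N a i.
Proof.
rewrite /block_word count_flatten -map_comp sumnE big_map.
under eq_bigr do rewrite /= count_nseq /=.
have [ia|ai] := ltnP i (size a); last first.
  rewrite nth_default // big_seq big1 // => j; rewrite mem_iota => /= ja.
  by case: eqP ai => // <-; rewrite leqNgt ja.
rewrite (bigD1_seq i) ?mem_iota ?iota_uniq //= eqxx mul1n big1 ?addn0 // => j.
by case: eqP.
Qed.

Lemma card_nth (s : seq nat) i :
  #|[pred k : 'I_(size s) | nth 0%N s k == i]| = count_mem i s.
Proof. by rewrite -sum1_card -sum1_count (big_nth 0%N) big_mkord. Qed.

Section BlockWord.
Variable a : composition.
Let w := block_word a.

(** The positions of the word, with their letters as block indices, form a concrete model of the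
    point set. *)
Lemma block_word_fibres i : #|[pred k : 'I_(size w) | nth 0%N w k == i]| = nth 0%N a i.
Proof. by rewrite card_nth count_block_word. Qed.

Lemma mem_block_word i : (i \in w) = (i < size a)%N.
Proof.
rewrite -has_pred1 has_count count_block_word; apply/idP/idP => [|ia].
  by apply: contraLR; rewrite -!leqNgt leqn0 => /(nth_default 0%N)->.
exact: (allP (parts_gt0 a) _ (mem_nth _ ia)).
Qed.

Section Fibres.
Variables (T : finType) (b : T -> nat).
Hypothesis fibb : forall i, #|[pred x | b x == i]| = nth 0%N a i.

Lemma linear_ext_blocks t : perm_eq t (enum T) ->
  linear_ext (fun x y => b x < b y)%N t -> sorted leq [seq b x | x <- t].
Proof.
move=> tT /forallP lt; have ut : uniq t by rewrite (perm_uniq tT) enum_uniq.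
rewrite sorted_map; case: t tT lt ut => // x0 t _ lt ut; apply/(sortedP x0) => k kt.
rewrite /= leqNgt; apply/negP => bk.
have /forallP/(_ (nth x0 (x0 :: t) k)) := lt (nth x0 (x0 :: t) k.+1).
by rewrite bk !index_uniq ?(ltnW kt) // ltnNge leqnSn.
Qed.

Lemma sorted_block_word t : perm_eq t (enum T) ->
  sorted leq [seq b x | x <- t] -> sorted leq w -> [seq b x | x <- t] = w.
Proof.
move=> tT st sw; apply: (sorted_eq leq_trans anti_leq) => //.
apply/allP => i _ /=; rewrite count_block_word -fibb.
rewrite (permP (perm_map b tT)) count_map -sum1_count big_enum_cond -sum1_card.
by apply/eqP/eq_bigl => x; rewrite !inE.
Qed.

End Fibres.

Lemma block_word_sorted : sorted leq w.
Proof.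
rewrite /w /block_word; set r := iota _ _; have : sorted leq r by exact: iota_sorted.
elim: r => // i r IHr /= ir; have /IHr sr := path_sorted ir.
rewrite sorted_pairwise ?pairwise_cat; last exact: leq_trans.
rewrite -!sorted_pairwise ?sr ?andbT; try exact: leq_trans.
apply/andP; split; last by elim: (nth _ _ _) => // -[|n] //= ->; rewrite leqnn.
apply/allrelP => x y /nseqP[-> _] /flattenP[z /mapP[j jr ->] /nseqP[-> _]].
move: ir; rewrite path_sortedE; last exact: leq_trans.
by case/andP=> /allP/(_ _ jr).
Qed.

Lemma block_word_mono j k : (j <= k < size w)%N -> (nth 0%N w j <= nth 0%N w k)%N.
Proof.
case/andP=> jk kw; apply: (sorted_leq_nth leq_trans leqnn 0%N block_word_sorted) => //.
by rewrite inE (leq_ltn_trans jk).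
Qed.

Lemma block_word0 : nth 0%N w 0 = 0%N.
Proof.
have [w0|] := posnP (size w); first by rewrite nth_default // w0.
move=> w_gt0; have w0 : 0%N \in w.
  have := mem_nth 0%N w_gt0; rewrite !mem_block_word; exact: leq_ltn_trans.
have := @block_word_mono 0%N (index 0%N w); rewrite index_mem w0 nth_index //.
by move/(_ isT); rewrite leqn0 => /eqP.
Qed.

(** All parts are positive, so no letter is skipped. *)
Lemma block_word_step k : (k.+1 < size w)%N -> (nth 0%N w k.+1 <= (nth 0%N w k).+1)%N.
Proof.
move=> kw; rewrite leqNgt; apply/negP => gap.
have iw : (nth 0%N w k).+1 \in w.
  rewrite mem_block_word; apply: ltn_trans gap _.
  by rewrite -mem_block_word mem_nth.
have [jk|kj] := leqP (index (nth 0%N w k).+1 w) k.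
  have := @block_word_mono _ _ (introT andP (conj jk (ltnW kw))).
  by rewrite nth_index // ltnn.
have := @block_word_mono k.+1 (index (nth 0%N w k).+1 w); rewrite kj index_mem iw.
by rewrite nth_index // leqNgt gap => /(_ isT).
Qed.

(** A linear extension lists the blocks in order, so its word of block indices is always [w], and at
    a block boundary the labeling alone decides between ascent and descent. *)
Lemma linext_blocks p : p \in linexts (comp_poset a) ->
  size p = size w /\ forall k, (k.+1 < size w)%N -> (nth 0%N w k < nth 0%N w k.+1)%N ->
    ascent p k = odd (nth 0%N w k) || ~~ odd (nth 0%N w k.+1).
Proof.
have fibb := block_word_fibres.
rewrite (perm_mem (linexts_perm (block_label_inj fibb) (block_label_perm fibb)
  (plt_block_label fibb))) => /mapP[t].
rewrite mem_filter mem_permutations => /andP[lt tT] ->.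
have wt := sorted_block_word fibb tT (linear_ext_blocks tT lt) block_word_sorted.
have szt : size t = size w by rewrite -[in RHS]wt size_map.
rewrite size_map; split=> // k kw; rewrite -szt in kw.
have x0 : 'I_(size w) by case: (t) kw.
have bE j : (j < size t)%N -> nth 0%N w j = nth 0%N w (nth x0 t j).
  by move=> jt; have := congr1 (nth 0%N ^~ j) wt; rewrite /= (nth_map x0).
rewrite (bE k (ltnW kw)) (bE k.+1 kw) /ascent !(nth_map x0) ?(ltnW kw) // => blt.
by rewrite block_label_lt.
Qed.

(** List even blocks by increasing and odd blocks by decreasing labels. Consecutive blocks have
    opposite parity, so a boundary is an ascent into an even block and a descent into an odd one. *)
Lemma linext_alternating :
  exists2 p, p \in linexts (comp_poset a) &
    forall k, (k.+1 < size w)%N -> ascent p k = ~~ odd (nth 0%N w k.+1).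
Proof.
have fibb := block_word_fibres.
pose b (k : 'I_(size w)) := nth 0%N w k; pose lab := block_label a b.
pose e x y := (b x < b y)%N || (b x == b y) &&
  (if odd (b x) then lab y <= lab x else lab x <= lab y)%N.
have et : transitive e.
  move=> y x z; rewrite /e => /orP[xy|/andP[/eqP-> xy]] /orP[yz|/andP[/eqP<- yz]].
  - by rewrite (ltn_trans xy yz).
  - by rewrite xy.
  - by rewrite yz.
  by rewrite eqxx orbC; move: xy yz; case: ifP => _; lia.
have etot : total e.
  move=> x y; rewrite /e; case: ltngtP => //= ->; case: ifP => _; exact: leq_total.
have er : reflexive e by move=> x; have := etot x x; rewrite orbb.
pose t := sort e (enum 'I_(size w)).
have st : sorted e t := sort_sorted etot _.
have tT : perm_eq t (enum 'I_(size w)) by rewrite perm_sort.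
have inT x : x \in t by rewrite (perm_mem tT) mem_enum.
have lt : linear_ext (fun x y => b x < b y)%N t.
  apply/forallP => x; apply/forallP => y; apply/implyP => xy; rewrite ltnNge.
  apply/negP => /(sorted_leq_index et er st _ _ (inT y) (inT x)).
  by rewrite /e ltnNge (ltnW xy) /= (gtn_eqF xy).
exists (map lab t).
  rewrite (perm_mem (linexts_perm (block_label_inj fibb) (block_label_perm fibb)
    (plt_block_label fibb))) map_f // mem_filter mem_permutations tT andbT.
  exact: lt.
have wt := sorted_block_word fibb tT (linear_ext_blocks tT lt) block_word_sorted.
have szt : size t = size w by rewrite -[in RHS]wt size_map.
move=> k kw; have := block_word_step kw; rewrite -szt in kw.
have x0 : 'I_(size w) by case: (t) kw.
have bE j : (j < size t)%N -> nth 0%N w j = b (nth x0 t j).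
  by move=> jt; have := congr1 (nth 0%N ^~ j) wt; rewrite /= (nth_map x0).
rewrite (bE k (ltnW kw)) (bE k.+1 kw) /ascent !(nth_map x0) ?(ltnW kw) //.
have := sortedP x0 st; move=> /(_ k kw); set x := nth x0 t k; set y := nth x0 t k.+1.
have nxy : lab x != lab y.
  rewrite (inj_eq (block_label_inj fibb)) nth_uniq ?(ltnW kw) //.
    by rewrite ltn_eqF.
  by rewrite (perm_uniq tT) enum_uniq.
move=> /orP[xy|/andP[/eqP xy exy]] step.
  rewrite [LHS](block_label_lt fibb xy) -/(b x) -/(b y).
  have -> : b y = (b x).+1 by lia.
  by rewrite /= negbK orbb.
by move: exy nxy; rewrite xy; case: ifP => _; lia.
Qed.

End BlockWord.

(** Induction along the words: from strictly below, one step cannot overtake. From a tie, if only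
    the word of [a] steps up, its boundary forces the opposite of what the parity of the unchanged
    letter of [c] prescribes. *)
Lemma alternating_dominates (a c : composition) p :
    size (block_word a) = size (block_word c) ->
    p \in linexts (comp_poset a) ->
    (forall k, (k.+1 < size (block_word c))%N ->
       ascent p k = ~~ odd (nth 0%N (block_word c) k.+1)) ->
  forall k, (k < size (block_word a))%N ->
    (nth 0%N (block_word a) k <= nth 0%N (block_word c) k)%N.
Proof.
move=> szE /linext_blocks[_ asc] des; elim=> [|k IHk] kw; first by rewrite block_word0.
have := IHk (ltnW kw); have := asc k kw; have := des k; rewrite -szE => /(_ kw) ->.
have := block_word_step kw; have := @block_word_mono c k k.+1.
rewrite leqnSn -szE kw => /(_ isT).
move: (nth _ _ k) (nth _ _ k.+1) (nth _ _ k) (nth _ _ k.+1) => c0 c1 a0 a1.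
by move=> c01; rewrite leq_eqVlt => /orP[/eqP->|]; lia.
Qed.

Lemma block_word_inj : injective block_word.
Proof.
move=> a c ac; apply/val_inj => /=.
have nthE i : nth 0%N a i = nth 0%N c i by rewrite -!count_block_word ac.
apply: (@eq_from_nth _ 0%N) => //; apply/eqP; rewrite eqn_leq.
by apply/andP; split; rewrite leqNgt -mem_block_word; [rewrite ac|rewrite -ac];
  rewrite mem_block_word ltnn.
Qed.

(** Turns the letterwise order into a numerical measure, on which the triangularity argument
    inducts. *)
Lemma dominated_sumn (a c : composition) :
    size (block_word a) = size (block_word c) ->
    (forall k, (k < size (block_word a))%N ->
      (nth 0%N (block_word a) k <= nth 0%N (block_word c) k)%N) ->
  a != c -> (sumn (block_word a) < sumn (block_word c))%N.
Proof.
move=> szE le; apply: contraR; rewrite -leqNgt => ca; apply/eqP/block_word_inj.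
apply: (@eq_from_nth _ 0%N) => // k kw.
have sE s : sumn s = (\sum_(i < size s) nth 0%N s i)%N.
  by rewrite sumnE (big_nth 0%N) big_mkord.
move: ca; rewrite !sE -szE.
have L := @leqif_sum _ xpredT _ _ _ (fun (i : 'I_(size (block_word a))) _ =>
  leqif_geq (le i (ltn_ord i))).
rewrite (geq_leqif L) => /forallP/(_ (Ordinal kw)) /= ge.
by apply/eqP; rewrite eqn_leq le.
Qed.

(** * Linear independence *)

Definition descents n (p : seq nat) : {set 'I_n.-1} := [set k | ~~ ascent p (val k)].

(** The least weakly increasing word that rises right after each position in [X]. Evaluation at its
    monomial counts the linear extensions whose descents lie in [X]. *)
Definition step_word n (X : {set 'I_n.-1}) : seq nat :=
  mkseq (fun k => count (mem [seq val i | i <- enum X]) (iota 0%N k)) n.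

Lemma step_wordS n (X : {set 'I_n.-1}) (k : 'I_n.-1) :
  nth 0%N (step_word X) k.+1 = (nth 0%N (step_word X) k + (k \in X))%N.
Proof.
have kn : (k.+1 < n)%N by have := ltn_ord k; lia.
rewrite /step_word !nth_mkseq ?(ltnW kn) // -{1}addn1 iotaD count_cat add0n /= addn0.
by rewrite (mem_map val_inj) mem_enum.
Qed.

Lemma step_word_sorted n (X : {set 'I_n.-1}) : sorted leq (step_word X).
Proof.
apply/(sortedP 0%N) => k; rewrite size_mkseq => kn; have kn1 : (k < n.-1)%N by lia.
by rewrite (step_wordS X (Ordinal kn1)) leq_addr.
Qed.

Lemma Nfun_step_word (a : composition) n (X : {set 'I_n.-1}) :
  Nfun a (mon (step_word X)) =
  \sum_(p <- linexts (comp_poset a) | size p == n) (descents n p \subset X)%:R.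
Proof.
rewrite /Nfun /qsymF fps_sumE [RHS]big_mkcond /=; apply: eq_bigr => p _.
rewrite Lfun_mon ?step_word_sorted // size_mkseq; case: eqP => //= szp.
congr (nat_of_bool _)%:R; rewrite szp; apply/allP/subsetP => [H k|H k].
  rewrite inE; apply: contraR => kX; have := H k; rewrite mem_iota ltn_ord /=.
  by rewrite step_wordS (negbTE kX) addn0 eqxx; apply.
rewrite mem_iota /= => kn; apply/implyP; apply: contraTT => asc.
have := H (Ordinal kn); rewrite inE /= => /(_ asc) kX.
by rewrite (step_wordS X (Ordinal kn)) kX /= addn1 neq_ltn ltnSn.
Qed.

(** A weak Möbius inversion on subsets: by induction on size the proper subsets contribute nothing,
    leaving [D X]. *)
Lemma subset_sum_eq0 (I : finType) (V : zmodType) (D : {set I} -> V) :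
  (forall X : {set I}, \sum_(Y : {set I} | Y \subset X) D Y = 0) -> forall X, D X = 0.
Proof.
move=> H X; elim: {X}_.+1 {-2}X (ltnSn #|X|) => // n IHn X Xn.
have := H X; rewrite (bigD1 X) //= big1 ?addr0 // => Y /andP[YX nYX]; apply: IHn.
by apply: leq_trans (proper_card _) Xn; rewrite properEneq nYX.
Qed.

(** Induction on the letter sum of the block word of [mu]. At the descent set of the alternating
    extension of [mu], any other contributing [nu] has a smaller letter sum, so its coefficient
    already vanishes. *)
Lemma Nfun_free (S : seq composition) (d : composition -> int) : uniq S ->
  \sum_(nu <- S) Nfun nu *~ d nu = 0 -> {in S, forall nu, d nu = 0}.
Proof.
move=> uS S0 mu; elim: {mu}_.+1 {-2}mu (ltnSn (sumn (block_word mu))) => // N IHN.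
move=> mu muN muS.
pose n := size (block_word mu).
pose D (X : {set 'I_n.-1}) := \sum_(nu <- S)
  (\sum_(p <- linexts (comp_poset nu) | size p == n)
     (descents n p == X)%:R) *~ d nu : int.
(* Evaluation at step words only gives sums of [D] over the subsets of [X]; inversion isolates the
   exact descent sets. *)
have D0 X : D X = 0.
  apply: (subset_sum_eq0 (D := D)) => {}X.
  transitivity ((\sum_(nu <- S) Nfun nu *~ d nu) (mon (step_word X))); last first.
    by rewrite S0.
  rewrite fps_sumE exchange_big /=; apply: eq_bigr => nu _.
  rewrite fps_mulz Nfun_step_word -mulrz_suml; congr (_ *~ _).
  rewrite exchange_big /=; apply: eq_bigr => p _.
  by rewrite sum_pred1 ?index_enum_uniq // mem_index_enum.
have [p pmu asc] := linext_alternating mu.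
have [szp _] := linext_blocks pmu.
have := D0 (descents n p); rewrite /D (bigD1_seq mu) //= [X in _ + X]big1_seq ?addr0.
  (* The factor of [d mu] counts extensions with the descents of [p]; it is positive since [p] is
     one of them. *)
  move/eqP; rewrite -mulrzr mulf_eq0 intr_eq0 => /orP[|/eqP //].
  rewrite (big_rem p) //= szp eqxx eqxx gt_eqF // addrC ltr_wpDl // sumr_ge0 //.
move=> nu /andP[nmu nuS].
have [/hasP[q qnu /andP[/eqP szq /eqP qp]]|/hasPn no] :=
    boolP (has (fun q => (size q == n) && (descents n q == descents n p))
      (linexts (comp_poset nu))).
  have [szq' _] := linext_blocks qnu.
  have szE : size (block_word nu) = size (block_word mu) by rewrite -szq' szq.
  rewrite (IHN nu) ?mulr0z //; rewrite ltnS in muN; apply: leq_trans muN.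
  apply: (dominated_sumn szE) nmu; apply: (alternating_dominates szE qnu) => k kn.
  rewrite -asc //; have kn1 : (k < n.-1)%N by rewrite /n; lia.
  by move/setP/(_ (Ordinal kn1)): qp; rewrite !inE => /negb_inj.
rewrite big1_seq ?mul0rz // => q /andP[szq qnu].
by have := no q qnu; rewrite szq /= => /negbTE->.
Qed.

(** * Finite combinations of the basis and their coefficients *)

Lemma NcombE (S : {fset composition}) (c : {fsfun composition -> int with 0}) :
  (finsupp c `<=` S)%fset -> Ncomb c = \sum_(nu <- S) Nfun nu *~ c nu.
Proof.
move=> cS; rewrite /Ncomb; apply: big_fset_incl => // nu _.
by move/(@fsfun_dflt _ _ _ c)->; rewrite mulr0z.
Qed.

(** Carries nonnegativity from one constructed expansion to every expansion of the same product. *)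
Lemma Ncomb_inj (c c' : {fsfun composition -> int with 0}) :
  Ncomb c = Ncomb c' -> c =1 c'.
Proof.
pose S := (finsupp c `|` finsupp c')%fset.
rewrite (@NcombE S c) ?fsubsetUl // (@NcombE S c') ?fsubsetUr // => cc' nu.
have [nuS|] := boolP (nu \in S); last first.
  by rewrite inE negb_or => /andP[/fsfun_dflt-> /fsfun_dflt->].
apply/eqP; rewrite -subr_eq0; apply/eqP.
apply: (Nfun_free (d := fun nu => c nu - c' nu) (fset_uniq S)) => //.
apply/eqP; under eq_bigr do rewrite mulrzBr.
by rewrite sumrB cc' subrr.
Qed.

(** Grouping the terms by index makes each coefficient a cardinality, hence nonnegative. *)
Lemma Ncomb_of_sum (B : finType) (P : pred B) (f : B -> composition) :
  exists2 c : {fsfun composition -> int with 0},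
    \sum_(b | P b) Nfun (f b) = Ncomb c &
    forall nu, 0 <= c nu /\ (nu \in finsupp c -> exists2 b, P b & f b = nu).
Proof.
pose S : {fset composition} := [fset f b | b in P]%fset.
pose c : {fsfun composition -> int with 0} :=
  [fsfun nu in S => (#|[pred b | P b & f b == nu]|%:Z) | 0]%fset.
have cE nu : c nu = #|[pred b | P b & f b == nu]|%:Z.
  rewrite fsfunE; case: ifP => // /negP nuS; apply/esym/eqP.
  rewrite eqz_nat eqn0Ngt; apply/negP => /card_gt0P[b /andP[Pb /eqP fb]].
  by case: nuS; apply/imfsetP; exists b.
have supp nu : nu \in finsupp c -> exists2 b, P b & f b = nu.
  rewrite mem_finsupp cE eqz_nat -lt0n => /card_gt0P[b /andP[Pb /eqP fb]].
  by exists b.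
exists c => [|nu]; last by split; [rewrite cE | exact: supp].
rewrite (@NcombE S); last first.
  apply/fsubsetP => nu /supp[b Pb <-]; exact: in_imfset.
transitivity (\sum_(nu <- S) \sum_(b | P b && (f b == nu)) Nfun nu); last first.
  apply: eq_bigr => nu _; rewrite cE -pmulrn -sumr_const.
  by apply: eq_bigl => b; rewrite inE.
rewrite (exchange_big_dep P) /= => [|nu b _ /andP[] //].
apply: eq_bigr => b Pb; rewrite Pb /=.
rewrite -big_filter (eq_filter (a2 := pred1 (f b))); last first.
  by move=> nu; rewrite /= eq_sym.
by rewrite filter_pred1_uniq ?fset_uniq ?in_imfset // big_seq1.
Qed.

Theorem theorem4p5 :
  (forall alpha beta : composition,
     in_Nspan (fun nu => rank nu == (rank alpha + rank beta)%N)
              (Nfun alpha * Nfun beta)) /\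
  (forall (alpha beta : composition) (c : {fsfun composition -> int with 0}),
     Nfun alpha * Nfun beta = Ncomb c ->
     forall nu : composition, 0 <= c nu).
Proof.
have main alpha beta : exists2 c : {fsfun composition -> int with 0},
    Nfun alpha * Nfun beta = Ncomb c &
    forall nu, 0 <= c nu /\
      (nu \in finsupp c -> rank nu = (rank alpha + rank beta)%N).
  have fib1 := block_word_fibres alpha; have fib2 := block_word_fibres beta.
  pose T : finType := ('I_(size (block_word alpha)) + 'I_(size (block_word beta)))%type.
  have [c cE cP] := Ncomb_of_sum
    (fun b : {ffun T -> 'I_#|{: T}|} =>
       shuffle (fun k => nth 0%N (block_word alpha) (val k))
       (fun k => nth 0%N (block_word beta) (val k)) (fun x => b x : nat))
    (fun b : {ffun T -> 'I_#|{: T}|} => fibre_sizes (fun x => b x : nat)).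
  exists c => [|nu]; first by rewrite (Nfun_mul fib1 fib2) -cE.
  have [c0 H] := cP nu; split=> // /H[b sb <-].
  exact: rank_shuffle fib1 fib2 _ sb.
split=> [alpha beta|alpha beta c cE nu].
  by have [c cE cP] := main alpha beta; exists c; split=> // nu /(proj2 (cP nu))->.
have [c' c'E c'P] := main alpha beta.
by rewrite (Ncomb_inj (etrans (esym cE) c'E)); case: (c'P nu).
Qed.
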